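(* For every nonlow c.e. degree $\mathbf{d}$, there is a c.e. set $A\in\mathbf{d}$ such that the complement $\overline{A}$ is semilow$_{1.5}$ but $\overline{A}$ is not semilow.
   Context: $\{W_e\}_{e\in\omega}$ is a standard (acceptable) enumeration of the computably enumerable (c.e.) subsets of $\omega$; $\overline{X}=\omega\setminus X$. A c.e. degree is a Turing degree containing a c.e. set. A set (or its degree) is low if its Turing jump is Turing equivalent to $\emptyset'$, and nonlow otherwise. A set $X\subseteq\omega$ is semilow if $\{e \mid W_e\cap X\neq\emptyset\}\leq_T \emptyset'$. A set $X$ is semilow$_{1.5}$ if $\{e\mid W_e\cap X \text{ is finite}\}\leq_1\emptyset''$ (one-one reducibility). *)

(* Defs.v *)
From mathcomp Require Import all_boot.
From mathcomp Require Import boolp classical_sets cardinality zify.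
From Stdlib Require Arith.Cantor.

Set Implicit Arguments.
Unset Strict Implicit.
Unset Printing Implicit Defensive.

Local Open Scope classical_set_scope.

(* Programs with an oracle are unary; tuples of arguments are passed through
   the Cantor bijection nat * nat -> nat. *)
Definition npair (x y : nat) : nat := Cantor.to_nat (x, y).
Definition nfst (z : nat) : nat := (Cantor.of_nat z).1.
Definition nsnd (z : nat) : nat := (Cantor.of_nat z).2.

Inductive code : Type :=
| Zero | Succ | Fst | Snd
| Oracle
| Pair of code & code
| Comp of code & code
| Prec of code & code
| Mu of code.

Definition chi (A : set nat) (x y : nat) : Prop :=
  (A x /\ y = 1) \/ (~ A x /\ y = 0).

(* [eval A c x y]: program [c] with oracle [A] halts on input [x] with output
   [y].  [Prec f g] sends <a, 0> to f a and <a, n+1> to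
   g <a, <n, Prec f g <a, n>>>; [Mu f] sends x to the least y such that
   f <x, y> = 0, with f <x, m> convergent for all m < y. *)
Fixpoint eval (A : set nat) (c : code) (x y : nat) {struct c} : Prop :=
  match c with
  | Zero => y = 0
  | Succ => y = x.+1
  | Fst => y = nfst x
  | Snd => y = nsnd x
  | Oracle => chi A x y
  | Pair f g => exists u v, [/\ eval A f x u, eval A g x v & y = npair u v]
  | Comp f g => exists2 z, eval A g x z & eval A f z y
  | Prec f g =>
      (fix rec (n r : nat) {struct n} : Prop :=
         match n with
         | 0 => eval A f (nfst x) r
         | n'.+1 => exists2 z, rec n' z
                             & eval A g (npair (nfst x) (npair n' z)) r
         end) (nsnd x) y
  | Mu f => eval A f (npair x y) 0 /\
            (forall m, m < y -> exists k, eval A f (npair x m) k.+1)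
  end.

Lemma eval_functional A c x y y' : eval A c x y -> eval A c x y' -> y = y'.
Proof.
elim: c x y y' => [||||| f IHf g IHg | f IHf g IHg | f IHf g IHg | f IHf]
  x y y' /=; try by move=> -> ->.
- by move=> [[a ->]|[a ->]] [[b ->]|[b ->]].
- move=> [u [v [fu gv ->]]] [u' [v' [fu' gv' ->]]].
  by rewrite (IHf _ _ _ fu fu') (IHg _ _ _ gv gv').
- move=> [z gz fz] [z' gz' fz']; move: fz'.
  by rewrite -(IHg _ _ _ gz gz') => /(IHf _ _ _ fz).
- elim: (nsnd x) y y' => [|n IHn] y y'; first exact: IHf.
  by move=> [z /IHn rz gz] [z' /rz <-]; exact: IHg.
- move=> [fy miny] [fy' miny']; case: (ltngtP y y') => // lt.
  + by have [k /(IHf _ _ _ fy)] := miny' _ lt.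
  + by have [k /(IHf _ _ _ fy')] := miny _ lt.
Qed.

Fixpoint encode (c : code) : nat :=
  match c with
  | Zero => 0
  | Succ => 1
  | Fst => 2
  | Snd => 3
  | Oracle => 4
  | Pair f g => 5 + 4 * npair (encode f) (encode g)
  | Comp f g => 6 + 4 * npair (encode f) (encode g)
  | Prec f g => 7 + 4 * npair (encode f) (encode g)
  | Mu f => 8 + 4 * encode f
  end.

Lemma npair_inj x y x' y' : npair x y = npair x' y' -> x = x' /\ y = y'.
Proof. by move=> /Cantor.to_nat_inj[-> ->]. Qed.

Lemma encode_inj : injective encode.
Proof.
elim=> [||||| f IHf g IHg | f IHf g IHg | f IHf g IHg | f IHf]
  [||||| f' g' | f' g' | f' g' | f'] //= E; try (by exfalso; lia);
  try (have /npair_inj[/IHf -> /IHg ->] //: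
    npair (encode f) (encode g) = npair (encode f') (encode g') by lia).
by have /IHf -> : encode f = encode f' by lia.
Qed.

Lemma encode_surj e : exists c, encode c = e.
Proof.
elim/ltn_ind: e => e IH.
case: (ltnP e 5) => [|e5].
  by case: e IH => [|[|[|[|[|e]]]]] // _ _;
    [exists Zero | exists Succ | exists Fst | exists Snd | exists Oracle].
pose q := (e - 5) %/ 4.
have qe : q < e by rewrite /q; lia.
have eE : e = 5 + 4 * q + (e - 5) %% 4 by rewrite /q; lia.
have [f Ef] : exists f, encode f = nfst q.
  apply: IH; have := Cantor.to_nat_non_decreasing (nfst q) (nsnd q).
  by rewrite -surjective_pairing Cantor.cancel_to_of; lia.
have [g Eg] : exists g, encode g = nsnd q.
  apply: IH; have := Cantor.to_nat_non_decreasing (nfst q) (nsnd q).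
  by rewrite -surjective_pairing Cantor.cancel_to_of; lia.
have Eq : npair (encode f) (encode g) = q.
  by rewrite Ef Eg /npair -surjective_pairing Cantor.cancel_to_of.
have [h Eh] := IH _ qe.
have : (e - 5) %% 4 < 4 by rewrite ltn_mod.
case: ((e - 5) %% 4) eE => [|[|[|[|//]]]] -> _.
- by exists (Pair f g); rewrite /= Eq; lia.
- by exists (Comp f g); rewrite /= Eq; lia.
- by exists (Prec f g); rewrite /= Eq; lia.
- by exists (Mu h); rewrite /= Eh; lia.
Qed.

(* By [encode_inj] and [encode_surj] every e is the index of exactly one
   program. *)
Definition Phi (A : set nat) (e x y : nat) : Prop :=
  exists2 c, encode c = e & eval A c x y.

Definition W (e : nat) : set nat := [set x | exists y, Phi set0 e x y].

Definition ce (A : set nat) : Prop := exists e, A = W e.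

Definition turing_le (B A : set nat) : Prop :=
  exists e, forall x y, Phi A e x y <-> chi B x y.

Definition turing_eq (A B : set nat) : Prop := turing_le A B /\ turing_le B A.

Definition jump (A : set nat) : set nat := [set e | exists y, Phi A e e y].

Definition computable (f : nat -> nat) : Prop :=
  exists e, forall x y, Phi set0 e x y <-> y = f x.

Definition one_le (B A : set nat) : Prop :=
  exists f, [/\ computable f, injective f & forall x, B x <-> A (f x)].

Definition low (A : set nat) : Prop := turing_eq (jump A) (jump set0).

(* A Turing degree is an equivalence class of [turing_eq]. *)
Definition turing_degree (d : set (set nat)) : Prop :=
  exists D, d = [set X | turing_eq X D].

Definition ce_degree (d : set (set nat)) : Prop :=
  turing_degree d /\ exists2 X, d X & ce X.

Definition low_degree (d : set (set nat)) : Prop := exists2 X, d X & low X.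

Definition semilow (X : set nat) : Prop :=
  turing_le [set e | W e `&` X !=set0] (jump set0).

Definition semilow15 (X : set nat) : Prop :=
  one_le [set e | finite_set (W e `&` X)] (jump (jump set0)).

(* Main.v *)
(* Let D be a nonlow c.e. set in the degree.  A number n is in the jump D' iff
   some candidate computation c is never refuted by the enumeration of D.  The
   complement of A is split into finite columns, one for each n: besides finitely
   many saved numbers, column n contains n+1 copies of the least candidate that
   is never refuted, if there is one.  A copy of a candidate enters A when the
   candidate is refuted, unless the copy has been saved.  For
   each e < n, the set W_e saves the first number of column n that it is seen to
   contain while the candidate of that number is still unrefuted.

   Hence, for e < n, W_e meets the complement of A in column n iff it contains,
   at some stage, a number of that column which is outside A at that stage.
   This condition is c.e., and columns are finite, so finiteness of
   W_e \ A is a Sigma_2 property of e: the complement of A is semilow_1.5.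
   At most n numbers are saved in column n, so n is in D' iff, for each j <= n,
   the c.e. set of all j-th copies in column n meets the complement of A.
   Therefore semilowness of the complement would make D low.  The same
   equivalence makes the complement of D, which is many-one reducible to D',
   c.e. in A, and A <=_T D because a copy is outside A iff its candidate is
   never refuted or it is saved. *)
Require Import Defs.
From mathcomp Require Import all_boot.
From mathcomp Require Import boolp classical_sets cardinality zify.
From Stdlib Require Cantor.

Set Implicit Arguments.
Unset Strict Implicit.
Unset Printing Implicit Defensive.

Local Open Scope classical_set_scope.

(** * Oracle-computable functions and predicates *)

Lemma nfst_pair x y : nfst (npair x y) = x.
Proof. by rewrite /nfst /npair Cantor.cancel_of_to. Qed.

Lemma nsnd_pair x y : nsnd (npair x y) = y.
Proof. by rewrite /nsnd /npair Cantor.cancel_of_to. Qed.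

Lemma npair_eta z : npair (nfst z) (nsnd z) = z.
Proof. by rewrite /npair -surjective_pairing Cantor.cancel_to_of. Qed.

Lemma npair_ge x y : x + y <= npair x y.
Proof. by have := Cantor.to_nat_non_decreasing x y; rewrite /npair; lia. Qed.

Definition npairE := (nfst_pair, nsnd_pair).

Opaque npair nfst nsnd.

Definition recin (O : set nat) (f : nat -> nat) : Prop :=
  exists c, forall x, eval O c x (f x).

Definition decin (O : set nat) (P : nat -> bool) : Prop :=
  recin O (fun x => P x : nat).

Definition idc : code := Pair Fst Snd.

Definition cst (n : nat) : code := iter n (Comp Succ) Zero.

Lemma eval_idc O x y : eval O idc x y <-> y = x.
Proof.
by split=> [[u [v [/= -> -> ->]]]|->]; [|exists (nfst x), (nsnd x)];
  rewrite npair_eta.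
Qed.

Lemma eval_cst O n x : eval O (cst n) x n.
Proof. by elim: n => [|n IHn] //=; exists n. Qed.

Lemma recin_ext O f g : f =1 g -> recin O f -> recin O g.
Proof. by move=> fg [c cP]; exists c => x; rewrite -fg. Qed.

Lemma recin_id O : recin O (fun x => x).
Proof. by exists idc => x; apply/eval_idc. Qed.

Lemma recin_const O n : recin O (fun _ => n).
Proof. by exists (cst n) => x; exact: eval_cst. Qed.

Lemma recin_comp O f g : recin O f -> recin O g -> recin O (fun x => f (g x)).
Proof. by move=> [c cP] [d dP]; exists (Comp c d) => x /=; exists (g x). Qed.

Lemma recin_fst O f : recin O f -> recin O (fun x => nfst (f x)).
Proof. by apply: recin_comp; exists Fst. Qed.

Lemma recin_snd O f : recin O f -> recin O (fun x => nsnd (f x)).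
Proof. by apply: recin_comp; exists Snd. Qed.

Lemma recin_succ O f : recin O f -> recin O (fun x => (f x).+1).
Proof. by apply: (@recin_comp _ S); exists Succ. Qed.

Lemma recin_pair O f g :
  recin O f -> recin O g -> recin O (fun x => npair (f x) (g x)).
Proof.
by move=> [c cP] [d dP]; exists (Pair c d) => x /=; exists (f x), (g x).
Qed.

(** * Primitive recursion, bounded quantifiers and arithmetic *)

Fixpoint prim (F : nat -> nat) (G : nat -> nat -> nat -> nat) (a n : nat) :=
  if n is n'.+1 then G a n' (prim F G a n') else F a.

Lemma recin_prim O F G f g :
  recin O F -> recin O (fun p => G (nfst p) (nfst (nsnd p)) (nsnd (nsnd p))) ->
  recin O f -> recin O g -> recin O (fun x => prim F G (f x) (g x)).
Proof.
move=> [c cP] [d dP] hf hg.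
have H : recin O (fun p => prim F G (nfst p) (nsnd p)).
  exists (Prec c d) => x /=; elim: (nsnd x) => [|n IHn] /=; first exact: cP.
  exists (prim F G (nfst x) n) => //.
  by have := dP (npair (nfst x) (npair n (prim F G (nfst x) n))); rewrite !npairE.
apply: recin_ext (recin_comp H (recin_pair hf hg)) => x; by rewrite !npairE.
Qed.

Fixpoint bex (n : nat) (P : nat -> bool) : bool :=
  if n is n'.+1 then P n' || bex n' P else false.

Definition ball (n : nat) (P : nat -> bool) : bool := ~~ bex n (fun i => ~~ P i).

Lemma bexP n (P : nat -> bool) : reflect (exists2 i, i < n & P i) (bex n P).
Proof.
elim: n => [|n IHn] /=; first by constructor=> -[].
apply: (iffP orP) => [[Pn|/IHn[i lin Pi]]|[i]]; first by exists n.
  by exists i => //; apply: ltnW.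
by rewrite ltnS leq_eqVlt => /predU1P[->|lin] Pi; [left | right; apply/IHn; exists i].
Qed.

Lemma ballP n (P : nat -> bool) : reflect (forall i, i < n -> P i) (ball n P).
Proof.
apply: (iffP negP) => [h i lin|h /bexP[i lin]]; last by rewrite h.
by case Pi: (P i) => //; case: h; apply/bexP; exists i; rewrite ?Pi.
Qed.

Ltac rec_step0 := lazymatch goal with
  | h : recin ?O ?f |- recin ?O ?f => exact: h
  | |- recin _ (fun x => x) => exact: recin_id
  | |- recin _ nfst => exact: (recin_fst (recin_id _))
  | |- recin _ nsnd => exact: (recin_snd (recin_id _))
  | |- recin _ (fun _ => ?n) => exact: recin_const
  | |- recin _ (fun x => (@?f x).+1) => apply: (@recin_succ _ f)
  | |- recin _ (fun x => npair (@?f x) (@?g x)) => apply: (@recin_pair _ f g)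
  | |- recin _ (fun x => nfst (@?f x)) => apply: (@recin_fst _ f)
  | |- recin _ (fun x => nsnd (@?f x)) => apply: (@recin_snd _ f)
  | h : recin ?O ?f |- recin ?O (fun x => ?f (@?g x)) =>
      apply: (@recin_comp _ f g h)
  end.

Lemma recin_iter O F f g :
  recin O F -> recin O f -> recin O g -> recin O (fun x => iter (f x) F (g x)).
Proof.
move=> hF hf hg.
apply: (@recin_ext _ (fun x => prim (fun a => a) (fun _ _ z => F z) (g x) (f x))) => [x|].
  by elim: (f x) => //= n ->.
by apply: recin_prim; repeat (rec_step0; cbv beta).
Qed.

Lemma recin_add O f g :
  recin O f -> recin O g -> recin O (fun x => f x + g x).
Proof.
move=> hf hg.
apply: (@recin_ext _ (fun x => prim (fun a => a) (fun _ _ z => z.+1) (f x) (g x))) => [x|].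
  by elim: (g x) => [|n /= ->]; rewrite ?addn0 ?addnS.
by apply: recin_prim; repeat (rec_step0; cbv beta).
Qed.

Lemma recin_mul O f g :
  recin O f -> recin O g -> recin O (fun x => f x * g x).
Proof.
move=> hf hg.
apply: (@recin_ext _ (fun x => prim (fun=> 0) (fun a _ z => a + z) (f x) (g x))) => [x|].
  by elim: (g x) => [|n /= ->]; rewrite ?muln0 ?mulnS.
by apply: recin_prim; repeat (first [rec_step0 | apply: recin_add]; cbv beta).
Qed.

Lemma recin_sub O f g :
  recin O f -> recin O g -> recin O (fun x => f x - g x).
Proof.
have hp h : recin O h -> recin O (fun x => (h x).-1).
  move=> hh; apply: (@recin_ext _ (fun x => prim (fun=> 0) (fun _ n _ => n) 0 (h x))).
    by move=> x; case: (h x).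
  by apply: recin_prim; repeat (rec_step0; cbv beta).
move=> hf hg.
apply: (@recin_ext _ (fun x => prim (fun a => a) (fun _ _ z => z.-1) (f x) (g x))) => [x|].
  by elim: (g x) => [|n /= ->]; rewrite ?subn0 ?subnS.
by apply: recin_prim; repeat (first [rec_step0 | apply: hp]; cbv beta).
Qed.

Lemma decin_ext O P Q : P =1 Q -> decin O P -> decin O Q.
Proof. by move=> PQ; apply: recin_ext => x; rewrite PQ. Qed.

Lemma decin_neg O P : decin O P -> decin O (fun x => ~~ P x).
Proof.
move=> hP; apply: recin_ext (recin_sub (recin_const O 1) hP) => x.
by case: (P x).
Qed.

Lemma decin_and O P Q : decin O P -> decin O Q -> decin O (fun x => P x && Q x).
Proof.
move=> hP hQ; apply: recin_ext (recin_mul hP hQ) => x; by case: (P x); case: (Q x).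
Qed.

Lemma decin_or O P Q : decin O P -> decin O Q -> decin O (fun x => P x || Q x).
Proof.
move=> hP hQ.
apply: decin_ext (decin_neg (decin_and (decin_neg hP) (decin_neg hQ))) => x.
by rewrite negb_and !negbK.
Qed.

Lemma decin_leq O f g : recin O f -> recin O g -> decin O (fun x => f x <= g x).
Proof.
move=> hf hg.
apply: recin_ext (recin_sub (recin_const O 1) (recin_sub hf hg)) => x.
by rewrite -subn_eq0; case: (f x - g x).
Qed.

Lemma decin_eq O f g : recin O f -> recin O g -> decin O (fun x => f x == g x).
Proof.
move=> hf hg; apply: decin_ext (decin_and (decin_leq hf hg) (decin_leq hg hf)).
by move=> x; rewrite eqn_leq.
Qed.

Lemma decin_comp O P f : decin O P -> recin O f -> decin O (fun x => P (f x)).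
Proof. by move=> hP hf; apply: (recin_comp hP hf). Qed.

Lemma decin_bex O f (P : nat -> nat -> bool) :
  recin O f -> decin O (fun p => P (nfst p) (nsnd p)) ->
  decin O (fun x => bex (f x) (P x)).
Proof.
move=> hf hP.
apply: (@recin_ext _ (fun x => prim (fun=> 0)
  (fun a n z => P a n || (0 < z) : nat) x (f x))) => [x|].
  by elim: (f x) => //= n ->; rewrite lt0b.
apply: recin_prim; try by repeat (rec_step0; cbv beta).
apply: decin_or; last by apply: decin_leq; repeat (rec_step0; cbv beta).
have : recin O (fun p => npair (nfst p) (nfst (nsnd p))) by repeat (rec_step0; cbv beta).
by move/(decin_comp hP); apply: decin_ext => x /=; rewrite !npairE.
Qed.

Lemma decin_ball O f (P : nat -> nat -> bool) :
  recin O f -> decin O (fun p => P (nfst p) (nsnd p)) ->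
  decin O (fun x => ball (f x) (P x)).
Proof.
move=> hf hP; apply: decin_neg.
by apply: (@decin_bex _ _ (fun x i => ~~ P x i)) => //; apply: decin_neg.
Qed.

Ltac rec_hook := fail.

Ltac rec_step := first [ rec_step0 | rec_hook | lazymatch goal with
  | h : decin ?O ?P |- decin ?O ?P => exact: h
  | |- recin _ (fun x => @?f x + @?g x) => apply: (@recin_add _ f g)
  | |- recin _ (fun x => @?f x * @?g x) => apply: (@recin_mul _ f g)
  | |- decin _ (fun x => @?P x && @?Q x) => apply: (@decin_and _ P Q)
  | |- decin _ (fun x => @?P x || @?Q x) => apply: (@decin_or _ P Q)
  | |- decin _ (fun x => ~~ @?P x) => apply: (@decin_neg _ P)
  | |- decin _ (fun x => @?f x == @?g x) => apply: (@decin_eq _ f g)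
  | |- decin _ (fun x => @?f x <= @?g x) => apply: (@decin_leq _ f g)
  | |- decin _ (fun x => bex (@?f x) (@?P x)) => apply: (@decin_bex _ f P)
  | |- decin _ (fun x => ball (@?f x) (@?P x)) => apply: (@decin_ball _ f P)
  | h : decin ?O ?P |- decin ?O (fun x => ?P (@?g x)) =>
      apply: (@decin_comp _ P g h)
  end ].

Ltac rec_tac := cbv beta; repeat (rec_step; cbv beta).

(** * Uniform indices and unbounded search *)

Lemma recin_cst O f : recin O f -> recin O (fun x => encode (cst (f x))).
Proof.
(* [6 + 4 * npair 1 z] is the index of [Comp Succ c] when [z] is the index of [c]. *)
move=> hf; apply: (@recin_ext _ (fun x => prim (fun=> 0)
  (fun _ _ z => 6 + 4 * npair 1 z) 0 (f x))) => [x|].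
  by elim: (f x) => //= n ->.
by apply: recin_prim; rec_tac.
Qed.

Definition smn (c : code) (x : nat) : code := Comp c (Pair (cst x) idc).

Lemma eval_Comp O f g x y :
  eval O (Comp f g) x y <-> exists2 z, eval O g x z & eval O f z y.
Proof. by []. Qed.

Lemma eval_Pair O f g x y : eval O (Pair f g) x y <->
  exists u v, [/\ eval O f x u, eval O g x v & y = npair u v].
Proof. by []. Qed.

Lemma eval_smn O c x w y : eval O (smn c x) w y <-> eval O c (npair x w) y.
Proof.
rewrite eval_Comp; split=> [[z /eval_Pair[u [v [hu /eval_idc -> ->]]]]|h].
  by rewrite (eval_functional hu (eval_cst O x w)).
exists (npair x w) => //; apply/eval_Pair; exists x, w; split=> //.
  exact: eval_cst.
exact/eval_idc.
Qed.

Lemma cst_inj : injective cst.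
Proof. by elim=> [|m IHm] [|n] //= [/IHm ->]. Qed.

Lemma smn_inj c : injective (fun x => encode (smn c x)).
Proof. by move=> x y /encode_inj[/cst_inj]. Qed.

Lemma recin_smn O c f : recin O f -> recin O (fun x => encode (smn c (f x))).
Proof.
move=> hf.
apply: (@recin_ext _ (fun x => 6 + 4 * npair (encode c)
  (5 + 4 * npair (encode (cst (f x))) (encode idc)))); first by [].
have h := recin_cst hf; rec_tac.
Qed.

Lemma PhiE O c x y : Phi O (encode c) x y <-> eval O c x y.
Proof. by split=> [[c' /encode_inj ->]|]; last exists c. Qed.

(** [Mu] looks for a zero, so it is applied to the negation of [P]; it halts at the least
    witness. *)
Lemma search_code O P : decin O P ->
  exists c, forall x, (exists y, eval O c x y) <-> exists w, P (npair x w).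
Proof.
move=> /decin_neg[c cP]; exists (Mu c) => x; split=> [[y [h _]]|hw].
  exists y; have := eval_functional h (cP _).
  by case: (P _).
case: (ex_minnP hw) => w Pw min_w; exists w; split=> [|m ltmw].
  by have := cP (npair x w); rewrite Pw.
exists 0; have := cP (npair x m); case Pm: (P _) => //.
by have := min_w _ Pm; lia.
Qed.

Lemma search_fun O (P : nat -> nat -> bool) :
  decin O (fun p => P (nfst p) (nsnd p)) -> (forall x, exists w, P x w) ->
  exists2 f, recin O f & forall x, P x (f x).
Proof.
move=> hP ex; exists (fun x => ex_minn (ex x)); last first.
  by move=> x; case: ex_minnP.
have /decin_neg[c cP] := hP; exists (Mu c) => x.
case: ex_minnP => w Pw min_w; split=> [|m ltmw].
  by have := cP (npair x w); rewrite !npairE Pw.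
exists 0; have := cP (npair x m); rewrite !npairE; case Pm: (P _ _) => //.
by have := min_w _ Pm; lia.
Qed.

Lemma recin_computable f : recin set0 f -> computable f.
Proof.
move=> [c cP]; exists (encode c) => x y; split=> [/PhiE h|->].
  exact: eval_functional h (cP x).
exact/PhiE.
Qed.

(** * Turing reducibility and reductions to the jump *)

Lemma chiE (B : set nat) x y : chi B x y <-> y = `[< B x >].
Proof.
case: (pselect (B x)) => [Bx|nBx].
  rewrite asboolT //; split=> [[[]|[]]//|->]; by left.
rewrite asboolF //; split=> [[[]|[]]//|->]; by right.
Qed.

Lemma turing_leE (B O : set nat) : turing_le B O <-> decin O (fun x => `[< B x >]).
Proof.
split=> [[e eP]|[c cP]].
  have [c cE] := encode_surj e; exists c => x.
  by apply/PhiE; rewrite cE; apply/eP/chiE.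
exists (encode c) => x y; rewrite PhiE chiE; split=> [h|->//].
exact: eval_functional h (cP x).
Qed.

Fixpoint osubst (q c : code) : code :=
  match c with
  | Oracle => q
  | Pair f g => Pair (osubst q f) (osubst q g)
  | Comp f g => Comp (osubst q f) (osubst q g)
  | Prec f g => Prec (osubst q f) (osubst q g)
  | Mu f => Mu (osubst q f)
  | _ => c
  end.

Lemma eval_osubst (B O : set nat) q c x y :
  (forall x, eval O q x `[< B x >]) -> eval B c x y -> eval O (osubst q c) x y.
Proof.
move=> hq; elim: c x y => [||||| f IHf g IHg | f IHf g IHg | f IHf g IHg | f IHf] x y //=.
- by move/chiE ->.
- by move=> [u [v [/IHf ? /IHg ? ?]]]; exists u, v.
- by move=> [z /IHg ? /IHf ?]; exists z.
- elim: (nsnd x) y => [|n IHn] y; first exact: IHf.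
  by move=> [z /IHn ? /IHg ?]; exists z.
- move=> [/IHf ? h]; split=> // m /h[k /IHf ?]; by exists k.
Qed.

Lemma recin_trans (B O : set nat) f : turing_le B O -> recin B f -> recin O f.
Proof.
move=> /turing_leE[q hq] [c cP]; exists (osubst q c) => x; exact: eval_osubst (cP x).
Qed.

Lemma turing_le_trans (A B C : set nat) :
  turing_le A B -> turing_le B C -> turing_le A C.
Proof. by move=> /turing_leE AB BC; apply/turing_leE; exact: recin_trans AB. Qed.

Lemma turing_le_refl (A : set nat) : turing_le A A.
Proof. by apply/turing_leE; exists Oracle => x; apply/chiE. Qed.

(** The s-m-n program for [x] discards its own input through [Fst], so running it on its own index
    asks only about [x]. *)
Lemma sigma1_le_jump O P : decin O P ->
  exists f, [/\ forall O', recin O' f, injective f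
    & forall x, (exists w, P (npair x w)) <-> jump O (f x)].
Proof.
move=> /search_code[c cP]; exists (fun x => encode (smn (Comp c Fst) x)).
split; [|exact: smn_inj|] => [O'|x]; first exact/recin_smn/recin_id.
rewrite -cP; split=> -[y hy]; exists y.
  by apply/PhiE/eval_smn; exists x => //=; rewrite nfst_pair.
move/PhiE/eval_smn: hy => -[z /= ->]; by rewrite nfst_pair.
Qed.

Lemma ce_uniform P : decin set0 P ->
  exists f, (forall O, recin O f) /\ forall x z,
    W (f x) z <-> exists w, P (npair (npair x z) w).
Proof.
move=> /search_code[c cP]; exists (fun x => encode (smn c x)).
split=> [O|x z]; first exact/recin_smn/recin_id.
rewrite -cP; split=> -[y hy]; exists y; exact/eval_smn/PhiE || exact/PhiE/eval_smn.
Qed.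

(** * Derivations of computations *)

Definition tri (e x y : nat) : nat := npair e (npair x y).
Definition te (t : nat) : nat := nfst t.
Definition tx (t : nat) : nat := nfst (nsnd t).
Definition ty (t : nat) : nat := nsnd (nsnd t).

Lemma teE e x y : te (tri e x y) = e. Proof. exact: nfst_pair. Qed.
Lemma txE e x y : tx (tri e x y) = x.
Proof. by rewrite /tx /tri !npairE. Qed.
Lemma tyE e x y : ty (tri e x y) = y.
Proof. by rewrite /ty /tri !npairE. Qed.
Definition triE := (teE, txE, tyE).

(* A number [tri e x y] stands for the claim [Phi O e x y]; [just E t] says that
   claim [t] follows in one step from earlier claims, where [E P] means that
   some earlier claim satisfies [P].  Answers of the oracle are not checked. *)
Definition just (E : (nat -> bool) -> bool) (t : nat) : bool :=
  [|| (te t == 0) && (ty t == 0),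
      (te t == 1) && (ty t == (tx t).+1),
      (te t == 2) && (ty t == nfst (tx t)),
      (te t == 3) && (ty t == nsnd (tx t)),
      te t == 4,
      E (fun a => E (fun b => [&& te t == 5 + 4 * npair (te a) (te b),
        tx a == tx t, tx b == tx t & ty t == npair (ty a) (ty b)])),
      E (fun a => E (fun b => [&& te t == 6 + 4 * npair (te a) (te b),
        tx b == tx t, tx a == ty b & ty t == ty a])),
      E (fun a => bex (te t) (fun g => [&& te t == 7 + 4 * npair (te a) g,
        nsnd (tx t) == 0, tx a == nfst (tx t) & ty t == ty a])),
      E (fun a => E (fun b => bex (te t) (fun f =>
        [&& te t == 7 + 4 * npair f (te b), te a == te t,
          nsnd (tx t) == (nsnd (tx a)).+1, nfst (tx a) == nfst (tx t),
          tx b == npair (nfst (tx a)) (npair (nsnd (tx a)) (ty a))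
          & ty t == ty b]))) |
      E (fun a => [&& te t == 8 + 4 * te a, tx a == npair (tx t) (ty t),
        ty a == 0 & ball (ty t) (fun m => E (fun b =>
          [&& te b == te a, tx b == npair (tx t) m & 0 < ty b]))])].

Lemma just_mono (E E' : (nat -> bool) -> bool) t :
  (forall P Q, subpred P Q -> E P -> E' Q) -> just E t -> just E' t.
Proof.
move=> h; rewrite /just.
case/or4P => [->|->|->|/or4P[->|->|e|/or3P[e|e|/orP[e|e]]]]; rewrite ?orbT //.
- have -> // : E' (fun a => E' (fun b => [&& te t == 5 + 4 * npair (te a) (te b),
        tx a == tx t, tx b == tx t & ty t == npair (ty a) (ty b)])).
    by apply: (h _ _ _ e) => a; apply: h.
  by rewrite !orbT.
- have -> // : E' (fun a => E' (fun b => [&& te t == 6 + 4 * npair (te a) (te b),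
        tx b == tx t, tx a == ty b & ty t == ty a])).
    by apply: (h _ _ _ e) => a; apply: h.
  by rewrite !orbT.
- by rewrite (h _ _ (fun _ => id) e) ?orbT.
- have -> // : E' (fun a => E' (fun b => bex (te t) (fun f =>
        [&& te t == 7 + 4 * npair f (te b), te a == te t,
          nsnd (tx t) == (nsnd (tx a)).+1, nfst (tx a) == nfst (tx t),
          tx b == npair (nfst (tx a)) (npair (nsnd (tx a)) (ty a))
          & ty t == ty b]))).
    by apply: (h _ _ _ e) => a; apply: h.
  by rewrite !orbT.
- have -> : E' (fun a => [&& te t == 8 + 4 * te a, tx a == npair (tx t) (ty t),
        ty a == 0 & ball (ty t) (fun m => E' (fun b =>
          [&& te b == te a, tx b == npair (tx t) m & 0 < ty b]))]).
    apply: (h _ _ _ e) => a /and4P[-> -> -> /ballP hm] /=.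
    by apply/ballP => m /hm; apply: h.
  by rewrite !orbT.
Qed.

Lemma just_sound O (E : (nat -> bool) -> bool) t :
  (forall P, E P -> exists2 a, Phi O (te a) (tx a) (ty a) & P a) ->
  (te t = 4 -> chi O (tx t) (ty t)) -> just E t -> Phi O (te t) (tx t) (ty t).
Proof.
move=> hE h4; rewrite /just.
case/or4P => [/andP[/eqP-> /eqP->]|/andP[/eqP-> /eqP->]|/andP[/eqP-> /eqP->]|].
- by exists Zero.
- by exists Succ.
- by exists Fst.
case/or4P => [/andP[/eqP-> /eqP->]|/eqP e4||]; first by exists Snd.
- by rewrite e4; exists Oracle => //; apply: h4.
- case/hE => a [f fa ha] /hE[b [g gb hb]].
  case/and4P => /eqP-> /eqP xa /eqP xb /eqP->.
  exists (Pair f g); first by rewrite /= fa gb.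
  by exists (ty a), (ty b); rewrite -{1}xa -xb.
case/or3P.
- case/hE => a [f fa ha] /hE[b [g gb hb]].
  case/and4P => /eqP-> /eqP xb /eqP xa /eqP->.
  exists (Comp f g); first by rewrite /= fa gb.
  by exists (ty b); [rewrite -xb | rewrite -xa].
- case/hE => a [f fa ha] /bexP[g' _].
  have [g gE] := encode_surj g'.
  case/and4P => /eqP-> /eqP n0 /eqP xa /eqP->.
  exists (Prec f g); first by rewrite /= fa gE.
  by rewrite /= n0 -xa.
case/orP.
- case/hE => a [p pa ha] /hE[b [g gb hb]] /bexP[f' _].
  have [f fE] := encode_surj f'.
  case/and4P => /eqP et /eqP ea /eqP n1 /and3P[/eqP aa /eqP xb /eqP->].
  have pE : p = Prec f g.
    by apply: encode_inj; rewrite pa ea et /= fE gb.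
  rewrite et; exists (Prec f g); first by rewrite /= fE gb.
  rewrite /= n1; exists (ty a); last by rewrite -aa -xb.
  by move: ha; rewrite pE /= aa.
- case/hE => a [f fa ha] /and4P[/eqP-> /eqP xa /eqP ya /ballP hm].
  exists (Mu f); first by rewrite /= fa.
  split=> [|m /hm/hE[b [f' fb hb]]]; first by rewrite -xa -ya.
  case/and3P => /eqP eb /eqP xb; move: hb; rewrite xb.
  have -> : f' = f by apply: encode_inj; rewrite fb fa.
  by case: (ty b) => // k hk _; exists k.
Qed.

(** The latest claim comes first, so each claim rests on the tail after it. *)
Fixpoint derivation (l : seq nat) : bool :=
  if l is t :: l' then just (has^~ l') t && derivation l' else true.

Lemma just_sub l l' t :
  {subset l <= l'} -> just (has^~ l) t -> just (has^~ l') t.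
Proof.
move=> ll'; apply: just_mono => P Q PQ /hasP[a al Pa].
by apply/hasP; exists a; [exact: ll' | exact: PQ].
Qed.

Lemma derivation_cat l1 l2 :
  derivation l1 -> derivation l2 -> derivation (l1 ++ l2).
Proof.
elim: l1 => //= t l1 IH /andP[j d1] d2; rewrite IH // andbT.
by apply: just_sub j => a; rewrite mem_cat => ->.
Qed.

(** Kept apart from [derivation], which thereby stays decidable without the oracle. *)
Definition consistent (O : set nat) (l : seq nat) : Prop :=
  forall t, t \in l -> te t = 4 -> chi O (tx t) (ty t).

Definition derivable O (t : nat) : Prop :=
  exists l, [/\ derivation l, consistent O l & t \in l].

Lemma derivation_sound O l t : derivation l -> consistent O l -> t \in l ->
  Phi O (te t) (tx t) (ty t).
Proof.
elim: l t => //= a l IH t /andP[j d] co; rewrite in_cons => /predU1P[->|tl].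
  apply: just_sound j => [P /hasP[b bl Pb]|]; last by apply: co; rewrite mem_head.
  by exists b => //; apply: IH => // c cl; apply: co; rewrite in_cons cl orbT.
by apply: IH => // c cl; apply: co; rewrite in_cons cl orbT.
Qed.

Lemma derivable_seq O (s : seq nat) : {in s, forall t, derivable O t} ->
  exists l, [/\ derivation l, consistent O l & {subset s <= l}].
Proof.
elim: s => [|t s IH] h; first by exists [::].
have [l1 [d1 c1 t1]] := h t (mem_head _ _).
have [|l2 [d2 c2 s2]] := IH; first by move=> a sa; apply: h; rewrite in_cons sa orbT.
exists (l1 ++ l2); split; first exact: derivation_cat.
  by move=> a; rewrite mem_cat => /orP[/c1|/c2].
move=> a; rewrite in_cons mem_cat => /predU1P[->|/s2 ->]; rewrite ?t1 ?orbT //.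
Qed.

Lemma derivable_step O (s : seq nat) e x y : {in s, forall a, derivable O a} ->
  (e = 4 -> chi O x y) -> just (has^~ s) (tri e x y) -> derivable O (tri e x y).
Proof.
move=> /derivable_seq[l [dl cl sl]] h4 j; exists (tri e x y :: l); split.
- by rewrite /= dl andbT; apply: just_sub j.
- by move=> a; rewrite in_cons => /predU1P[->|/cl]; rewrite ?triE.
- exact: mem_head.
Qed.

Lemma eval_Prec0 O f g a y :
  eval O (Prec f g) (npair a 0) y <-> eval O f a y.
Proof. by rewrite /= !npairE. Qed.

Lemma eval_PrecS O f g a n y : eval O (Prec f g) (npair a n.+1) y <->
  exists2 z, eval O (Prec f g) (npair a n) z & eval O g (npair a (npair n z)) y.
Proof. by rewrite /= !npairE. Qed.

Lemma eval_derivable O c x y : eval O c x y -> derivable O (tri (encode c) x y).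
Proof.
elim: c x y => [||||| f IHf g IHg | f IHf g IHg | f IHf g IHg | f IHf] x y.
- by move=> ->; apply: (@derivable_step _ [::]) => //; rewrite /just !triE !eqxx.
- by move=> ->; apply: (@derivable_step _ [::]) => //; rewrite /just !triE !eqxx !orbT.
- by move=> ->; apply: (@derivable_step _ [::]) => //; rewrite /just !triE !eqxx !orbT.
- by move=> ->; apply: (@derivable_step _ [::]) => //; rewrite /just !triE !eqxx !orbT.
- by move=> h; apply: (@derivable_step _ [::]) => //; rewrite /just !triE !orbT.
- move=> /eval_Pair[u [v [/IHf df /IHg dg ->]]].
  apply: (@derivable_step _ [:: tri (encode f) x u; tri (encode g) x v]).
  + by move=> a; rewrite !inE => /orP[] /eqP->.
  + by rewrite /=; lia.
  by rewrite /just /has !triE !eqxx /= !orbT.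
- move=> /eval_Comp[z /IHg dg /IHf df].
  apply: (@derivable_step _ [:: tri (encode f) z y; tri (encode g) x z]).
  + by move=> a; rewrite !inE => /orP[] /eqP->.
  + by rewrite /=; lia.
  by rewrite /just /has !triE !eqxx /= !orbT.
(* This puts the indices of [f] and [g] below that of [Prec f g], within reach of the bounded
   searches in [just]. *)
- have fge := npair_ge (encode f) (encode g).
  have E : encode (Prec f g) = 7 + 4 * npair (encode f) (encode g) by [].
  rewrite -(npair_eta x); move: (nfst x) => a.
  elim: (nsnd x) y => [|n IHn] y.
    move=> /eval_Prec0/IHf df; apply: (@derivable_step _ [:: tri (encode f) a y]).
    + by move=> b; rewrite !inE => /eqP->.
    + by rewrite E; lia.
    rewrite /just /has !triE !npairE !eqxx.
    set b := bex _ _; have -> : b; last by rewrite !orbT.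
    by apply/bexP; exists (encode g); rewrite E ?eqxx; first lia.
  move=> /eval_PrecS[z /IHn dz /IHg dg]; apply: (@derivable_step _
    [:: tri (encode (Prec f g)) (npair a n) z;
        tri (encode g) (npair a (npair n z)) y]).
  + by move=> b; rewrite !inE => /orP[] /eqP->.
  + by rewrite E; lia.
  rewrite /just /has !triE !npairE !eqxx.
  set b := bex _ (fun=> [&& _ == 7 + 4 * npair _ (encode g), true & _]).
  have -> : b; last by rewrite !orbT.
  by apply/bexP; exists (encode f); rewrite E ?eqxx; first lia.
- move=> [hy hm].
  have E : encode (Mu f) = 8 + 4 * encode f by [].
  (* [k m] is the predecessor of the value of [f] at [m < y]; the default 0 for other [m] is never
     listed. *)
  have /choice[k hk] : forall m, exists k, m < y -> eval O f (npair x m) k.+1.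
    by move=> m; case: (ltnP m y) => [/hm[k ?]|]; [exists k | exists 0].
  apply: (@derivable_step _ (tri (encode f) (npair x y) 0 ::
    [seq tri (encode f) (npair x m) (k m).+1 | m <- iota 0 y])).
  + move=> b; rewrite inE => /predU1P[->|/mapP[m]]; first exact: IHf.
    by rewrite mem_iota => /hk/IHf dm ->.
  + by rewrite E; lia.
  rewrite /just [X in [|| _, _, _, _, _, _, _, _, _ | X]]/= !triE !eqxx /=.
  set b := ball _ _; have -> : b; last by rewrite !orbT.
  apply/ballP => m lt_my; apply/orP; right; apply/hasP.
  exists (tri (encode f) (npair x m) (k m).+1); last by rewrite !triE !eqxx.
  by apply/mapP; exists m; rewrite ?mem_iota.
Qed.

Lemma Phi_derivable O e x y : Phi O e x y <-> derivable O (tri e x y).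
Proof.
split=> [[c <-]|[l [dl cl]]]; first exact: eval_derivable.
by move/(derivation_sound dl cl); rewrite !triE.
Qed.

(** * Numerical codes of derivations, and halting *)

Definition item (S i : nat) : nat := nfst (iter i nsnd S).

(** The length is stored separately because [item] never runs out of entries. *)
Definition claims (L : nat) : seq nat := mkseq (item (nsnd L)) (nfst L).

Lemma claims_surj l : exists L, claims L = l.
Proof.
exists (npair (size l) (foldr npair 0 l)); rewrite /claims !npairE.
apply: (@eq_from_nth _ 0) => [|i]; rewrite size_mkseq // => il.
rewrite nth_mkseq //; elim: l i il => //= a l IH [|i] il.
  by rewrite /item nfst_pair.
by rewrite /item iterSr nsnd_pair; exact: IH.
Qed.

Definition claimed (L : nat) (P : nat -> bool) : bool :=
  bex (nfst L) (fun i => P (item (nsnd L) i)).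

Lemma claimedP L P : claimed L P = has P (claims L).
Proof.
apply/bexP/hasP => [[i il Pi]|[t /mapP[i]]].
  by exists (item (nsnd L) i) => //; apply/mapP; exists i; rewrite ?mem_iota.
by rewrite mem_iota => il -> Pi; exists i.
Qed.

Definition deriv (L : nat) : bool :=
  ball (nfst L) (fun i => just
    (fun P => bex (nfst L) (fun j => (i < j) && P (item (nsnd L) j)))
    (item (nsnd L) i)).

Lemma derivationE l : derivation l <->
  forall i, i < size l -> just (has^~ (drop i.+1 l)) (nth 0 l i).
Proof.
elim: l => //= a l IH; split.
  by move=> /andP[ja /IH h] [|i] /=; [rewrite drop0 | exact: h].
move=> h; have /= := h 0 isT; rewrite drop0 => -> /=.
by apply/IH => i il; exact: (h i.+1).
Qed.

Lemma derivP L : reflect (derivation (claims L)) (deriv L).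
Proof.
have sz : size (claims L) = nfst L by rewrite size_mkseq.
apply: (iffP (ballP _ _)) => h; [apply/derivationE | move/derivationE: h => h] => i.
  rewrite sz => il; have := h i il; rewrite nth_mkseq //.
  apply: just_mono => P Q PQ /bexP[j jl /andP[ij Pj]].
  apply/hasP; exists (item (nsnd L) j); last exact: PQ.
  have <- : nth 0 (drop i.+1 (claims L)) (j - i.+1) = item (nsnd L) j.
    by rewrite nth_drop subnKC // nth_mkseq.
  by apply: mem_nth; rewrite size_drop sz; lia.
move=> il; have := h i; rewrite sz nth_mkseq // => /(_ il).
apply: just_mono => P Q PQ /(hasP)[t /(nthP 0)[j]].
rewrite size_drop sz nth_drop => jl; rewrite nth_mkseq; last by lia.
by move=> <- Pj; apply/bexP; exists (i.+1 + j); [lia | rewrite PQ // andbT; lia].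
Qed.

Lemma recin_item O f g :
  recin O f -> recin O g -> recin O (fun x => item (f x) (g x)).
Proof.
move=> hf hg; apply: recin_fst.
by apply: recin_iter => //; exact: recin_snd (recin_id _).
Qed.

Ltac rec_hook ::= lazymatch goal with
  | |- recin _ (fun x => item (@?f x) (@?g x)) => apply: (@recin_item _ f g)
  end.

Lemma decin_deriv O f : recin O f -> decin O (fun x => deriv (f x)).
Proof.
move=> hf; have : decin O deriv; last by move/decin_comp; apply.
rewrite /deriv /just /te /tx /ty.
rec_tac.
Qed.

Definition halts (e x L : nat) : bool :=
  deriv L && claimed L (fun t => (te t == e) && (tx t == x)).

(** The use principle: a halting computation is a finite object, and the oracle matters only for its
    finitely many answers. *)
Lemma halting O e x :
  (exists y, Phi O e x y) <-> exists2 L, halts e x L & consistent O (claims L).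
Proof.
split=> [[y /Phi_derivable[l [dl cl tl]]]|[L /andP[/derivP dL]]].
  have [L Ll] := claims_surj l; exists L; rewrite ?Ll // /halts claimedP Ll.
  apply/andP; split; first by apply/derivP; rewrite Ll.
  by apply/hasP; exists (tri e x y); rewrite // !triE !eqxx.
rewrite claimedP => /hasP[t tL /andP[/eqP <- /eqP <-]] cL.
by exists (ty t); exact: derivation_sound dL cL tL.
Qed.

Lemma decin_halts O f g h : recin O f -> recin O g -> recin O h ->
  decin O (fun x => halts (f x) (g x) (h x)).
Proof.
move=> hf hg hh; apply: decin_and; first exact: decin_deriv.
by rewrite /claimed /te /tx; rec_tac.
Qed.

(** All oracle answers in [L] are 0, as the empty oracle demands; this is a decidable matrix for
    membership in [W e]. *)
Definition enters (e x L : nat) : bool :=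
  halts e x L && ~~ claimed L (fun t => (te t == 4) && (0 < ty t)).

Lemma W_enters e x : W e x <-> exists L, enters e x L.
Proof.
rewrite [W e x]halting; split=> [[L hL cL]|[L /andP[hL nL]]]; exists L => //.
  rewrite /enters hL claimedP; apply/hasPn => t tL; apply/negP => /andP[/eqP t4].
  by case: (cL t tL t4) => -[//] _ ->.
move=> t tL t4; right; split=> //; apply/eqP; apply: contraNT nL => t0.
by rewrite claimedP; apply/hasP; exists t; rewrite // t4 eqxx lt0n.
Qed.

Lemma decin_enters O f g h : recin O f -> recin O g -> recin O h ->
  decin O (fun x => enters (f x) (g x) (h x)).
Proof.
move=> hf hg hh; apply: decin_and; first exact: decin_halts.
by rewrite /claimed /te /ty; rec_tac.
Qed.

(** * Enumerability, Post's theorem and finite choices *)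

Lemma ce_search P : decin set0 P -> ce [set x | exists w, P (npair x w)].
Proof.
move=> /search_code[c cP]; exists (encode c); apply/seteqP; split=> x.
  by move/cP => [y hy]; exists y; apply/PhiE.
by move=> [y /PhiE hy]; apply/cP; exists y.
Qed.

(** Post's theorem: search for a witness of either side; one exists, and the one found decides. *)
Lemma turing_le_delta1 (B : set nat) O P Q : decin O P -> decin O Q ->
  (forall x, B x <-> exists w, P (npair x w)) ->
  (forall x, ~ B x <-> exists w, Q (npair x w)) -> turing_le B O.
Proof.
move=> hP hQ BP BQ.
have [|x|f hf fP] := @search_fun O (fun x w => P (npair x w) || Q (npair x w)).
- by rec_tac.
- case: (pselect (B x)) => [/BP|/BQ] [w hw]; exists w; by rewrite hw ?orbT.
apply/turing_leE; apply: (@decin_ext _ (fun x => P (npair x (f x)))); last by rec_tac.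
move=> x; case: asboolP => [Bx|nBx].
  by case/orP: (fP x) => // Qx; case: (BQ x).2 => //; exists (f x).
by apply/negP => Px; apply: nBx; apply/BP; exists (f x).
Qed.

Lemma turing_le_many_one (B C : set nat) f :
  recin C f -> (forall x, B x <-> C (f x)) -> turing_le B C.
Proof.
move=> hf BC; apply/turing_leE; have /turing_leE hC := turing_le_refl C.
apply: (@decin_ext _ (fun x => `[< C (f x) >])); last exact: (recin_comp hC hf).
by move=> x; apply: asbool_equiv_eq; split=> /BC.
Qed.

Lemma ex_least (P : nat -> Prop) :
  (exists n, P n) -> exists2 n, P n & forall m, m < n -> ~ P m.
Proof.
move=> exP; have exP' : exists n, `[< P n >] by case: exP => n /asboolP; exists n.
case: (ex_minnP exP') => n /asboolP Pn min_n; exists n => // m ltmn /asboolP/min_n.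
by rewrite leqNgt ltmn.
Qed.

Lemma uniform_bound (I : eqType) (s : seq I) (P : I -> nat -> Prop) :
  (forall i m n, m <= n -> P i m -> P i n) ->
  (forall i, i \in s -> exists n, P i n) -> exists n, forall i, i \in s -> P i n.
Proof.
move=> mono; elim: s => [|a s IH] h; first by exists 0.
have [m Pm] := h a (mem_head _ _).
have [|n Pn] := IH; first by move=> i si; apply: h; rewrite in_cons si orbT.
exists (maxn m n) => i; rewrite in_cons => /predU1P[->|/Pn].
  by apply: mono Pm; exact: leq_maxl.
by apply: mono; exact: leq_maxr.
Qed.

Lemma finite_functional (n : nat) (R : nat -> nat -> Prop) :
  (forall i x y, R i x -> R i y -> x = y) ->
  finite_set [set x | exists2 i, i < n & R i x].
Proof.
move=> Rfun.
have /choice[f fP] : forall i, exists y, forall x, R i x -> y = x.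
  move=> i; case: (pselect (exists y, R i y)) => [[y Ry]|nR].
    by exists y => x; exact: Rfun.
  by exists 0 => x Rx; case: nR; exists x.
apply: (@sub_finite_set _ _ (f @` `I_n)); last exact/finite_image/finite_II.
by move=> x [i ltin /fP <-]; exists i.
Qed.

(** One number codes all [n] witnesses, which moves an existential quantifier in front of a bounded
    universal one. *)
Lemma item_seq (n : nat) (R : nat -> nat -> Prop) :
  (forall i, i < n -> exists z, R i z) ->
  exists S, forall i, i < n -> R i (item S i).
Proof.
move=> h; have /choice[f fP] : forall i, exists z, i < n -> R i z.
  by move=> i; case: (ltnP i n) => [/h[z]|]; [exists z | exists 0].
have [L LE] := claims_surj (mkseq f n); exists (nsnd L) => i ltin.
have sz : nfst L = n by rewrite -(size_mkseq f n) -LE size_mkseq.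
have -> : item (nsnd L) i = nth 0 (claims L) i by rewrite nth_mkseq ?sz.
by rewrite LE nth_mkseq //; exact: fP.
Qed.

(** * The construction *)

Section Construction.

(** [bad n c s] is read: candidate [c] for [n] has been refuted by stage [s]. *)
Variable bad : nat -> nat -> nat -> bool.

Hypothesis decin_bad : forall O f g h, recin O f -> recin O g -> recin O h ->
  decin O (fun x => bad (f x) (g x) (h x)).

Hypothesis bad_mono : forall n c s t, s <= t -> bad n c s -> bad n c t.

(* A number z = <n, <c, <t, j>>> is the j-th copy of candidate c in column n.
   The stage t is the first one at which all smaller candidates are bad: this
   makes t a function of c and leaves, besides the saved numbers, only copies of
   the least candidate that never becomes bad outside the set [built]. *)
Definition zn (z : nat) : nat := nfst z.
Definition zc (z : nat) : nat := nfst (nsnd z).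
Definition zt (z : nat) : nat := nfst (nsnd (nsnd z)).
Definition zj (z : nat) : nat := nsnd (nsnd (nsnd z)).

Definition start (z : nat) : bool :=
  [&& zj z <= zn z, ball (zc z) (fun c => bad (zn z) c (zt z))
    & ball (zt z) (fun t => bex (zc z) (fun c => ~~ bad (zn z) c t))].

(* In w = <z, L> the number L witnesses that z is in W_e; w itself serves as the
   stage at which this is noticed. *)
Definition hit (e n w : nat) : bool :=
  [&& zn (nfst w) == n, start (nfst w), enters e (nfst w) (nsnd w)
    & ~~ bad n (zc (nfst w)) w].

Definition choice_at (e n w : nat) : bool :=
  hit e n w && ball w (fun w' => ~~ hit e n w').

(** Only indices [e < n] save in column [n], each at most one number, so fewer numbers are saved
    than the [n+1] copies. *)
Definition kept (z s : nat) : bool :=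
  bex (zn z) (fun e => bex s (fun w => choice_at e (zn z) w && (nfst w == z))).

Definition alive (z s : nat) : bool :=
  start z && (~~ bad (zn z) (zc z) s || kept z s).

Definition built : set nat := [set z | exists s, ~~ alive z s].

Lemma decin_start O f : recin O f -> decin O (fun x => start (f x)).
Proof.
move=> hf; rewrite /start /zj /zn /zt /zc.
by repeat (first [rec_step | apply: decin_bad]; cbv beta).
Qed.

Lemma decin_choice O f g h : recin O f -> recin O g -> recin O h ->
  decin O (fun x => choice_at (f x) (g x) (h x)).
Proof.
move=> hf hg hh; rewrite /choice_at /hit /zn /zc.
by repeat (first [rec_step | apply: decin_start | apply: decin_enters
  | apply: decin_bad]; cbv beta).
Qed.

Lemma decin_alive O f g : recin O f -> recin O g ->
  decin O (fun x => alive (f x) (g x)).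
Proof.
move=> hf hg; rewrite /alive /kept /zn /zc.
by repeat (first [rec_step | apply: decin_start | apply: decin_choice
  | apply: decin_bad]; cbv beta).
Qed.

Lemma choice_uniq e n w w' : choice_at e n w -> choice_at e n w' -> w = w'.
Proof.
move=> /andP[hw /ballP mw] /andP[hw' /ballP mw'].
by case: (ltngtP w w') => // lt; [have := mw' _ lt | have := mw _ lt]; rewrite ?hw ?hw'.
Qed.

(** * Survival of saved numbers and finiteness of columns *)

Lemma notin_built z : ~ built z <-> forall s, alive z s.
Proof.
split=> [nA s|al [s]]; last by rewrite al.
by apply: contra_notT nA => h; exists s.
Qed.

Lemma choice_notin_built e n w : e < n -> choice_at e n w -> ~ built (nfst w).
Proof.
move=> lten cw; apply/notin_built => s.
have /andP[/and4P[/eqP zw st _ nb] _] := cw.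
rewrite /alive st /= zw; case bs: (bad _ _ s) => //=.
apply/bexP; exists e; rewrite ?zw //; apply/bexP; exists w; last by rewrite cw eqxx.
(* Saving precedes refutation: if [s <= w], the candidate would already be bad at stage [w]. *)
by rewrite ltnNge; apply: contraNN nb => /bad_mono; apply.
Qed.

Definition meets (e n w : nat) : bool :=
  [&& zn (nfst w) == n, enters e (nfst w) (nsnd w) & alive (nfst w) w].

(** A number seen in [W e] while alive is either already saved, or unrefuted; in the latter case
    [W e] saves some number of the column, possibly another one. *)
Lemma meetsP e n : e < n ->
  (exists w, meets e n w) <-> exists z, [/\ W e z, zn z = n & ~ built z].
Proof.
move=> lten; split=> [[w /and3P[/eqP zw ew /andP[st]]]|[z [/W_enters[L eL] zz]]].
  rewrite zw => /orP[nb|].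
    have hw : exists w, hit e n w by exists w; rewrite /hit zw st ew nb eqxx.
    case: (ex_minnP hw) => v hv min_v.
    have cv : choice_at e n v.
      rewrite /choice_at hv; apply/ballP => u ltuv; apply/negP => /min_v.
      by rewrite leqNgt ltuv.
    have /and4P[/eqP zv _ ev _] := hv; exists (nfst v); split=> //.
      by apply/W_enters; exists (nsnd v).
    exact: choice_notin_built cv.
  rewrite /kept zw => /bexP[e' lte' /bexP[w' _ /andP[cw' /eqP ww]]].
  exists (nfst w); split=> //; first by apply/W_enters; exists (nsnd w).
  by rewrite -ww; exact: choice_notin_built cw'.
move/notin_built => al; exists (npair z L).
by rewrite /meets !npairE zz eL al eqxx.
Qed.

(** If the candidates differed, [start] would make the smaller one bad. Once they agree, the stage
    is the first at which all smaller candidates are bad. *)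
Lemma start_uniq z z' : start z -> start z' -> zn z = zn z' -> zj z = zj z' ->
  (forall s, ~~ bad (zn z) (zc z) s) -> (forall s, ~~ bad (zn z') (zc z') s) ->
  z = z'.
Proof.
move=> /and3P[_ /ballP bz /ballP tz] /and3P[_ /ballP bz' /ballP tz'] En Ej nz nz'.
have Ec : zc z = zc z'.
  case: (ltngtP (zc z) (zc z')) => // lt.
    by have := nz (zt z'); rewrite En bz'.
  by have := nz' (zt z); rewrite -En bz.
have Et : zt z = zt z'.
  case: (ltngtP (zt z) (zt z')) => // lt.
    by have /bexP[c ltc] := tz' _ lt; rewrite -En bz // Ec.
  by have /bexP[c ltc] := tz _ lt; rewrite En bz' // -Ec.
move: En Ec Et Ej; rewrite /zn /zc /zt /zj => En Ec Et Ej.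
by rewrite -(npair_eta z) -(npair_eta (nsnd z)) -(npair_eta (nsnd (nsnd z)))
  En Ec Et Ej !npair_eta.
Qed.

(** A survivor with a refuted candidate was saved by some [e < n] ([R1]); any other is determined by
    its copy number ([R2]). *)
Lemma column_finite n : finite_set [set z | zn z = n /\ ~ built z].
Proof.
pose R1 e z := exists2 w, choice_at e n w & nfst w = z.
pose R2 j z := [/\ start z, zn z = n, zj z = j
  & forall s, ~~ bad (zn z) (zc z) s].
have f1 : finite_set [set z | exists2 e, e < n & R1 e z].
  by apply: finite_functional => e z z' [w cw <-] [w' cw' <-]; rewrite (choice_uniq cw cw').
have f2 : finite_set [set z | exists2 j, j < n.+1 & R2 j z].
  apply: finite_functional => j z z' [sz nz jz bz] [sz' nz' jz' bz'].
  by apply: start_uniq => //; rewrite ?nz ?jz.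
have : finite_set ([set z | exists2 e, e < n & R1 e z] `|`
    [set z | exists2 j, j < n.+1 & R2 j z]) by rewrite finite_setU.
apply: sub_finite_set.
move=> z [zz /notin_built al].
case: (pselect (exists s, bad n (zc z) s)) => [[s bs]|nb].
  left; have /andP[_] := al s; rewrite /kept zz bs => /bexP[e lte].
  by move=> /bexP[w _ /andP[cw /eqP wz]]; exists e => //; exists w.
right; have /andP[sz _] := al 0; have /and3P[jz _ _] := sz.
exists (zj z); first by rewrite ltnS -zz.
by split=> // s; rewrite zz; apply/negP => bs; apply: nb; exists s.
Qed.

(** [meetsP] governs the columns beyond [e]; the remaining ones are finitely many and finite. *)
Lemma finite_meets e : finite_set (W e `&` ~` built) <->
  exists m, ~ exists p, [&& m <= nfst p, e < nfst p & meets e (nfst p) (nsnd p)].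
Proof.
split=> [fin|[m nm]].
  have /finite_seqP[s sE] := fin.
  have [m hm] : exists m, forall z, z \in s -> zn z < m.
    apply: uniform_bound => [i a b ab|z _]; first by move/leq_trans; apply.
    by exists (zn z).+1.
  exists m => -[p /and3P[mp ep hp]].
  have [z [Wz zz nz]] : exists z, [/\ W e z, zn z = nfst p & ~ built z].
    by apply/meetsP => //; exists (nsnd p).
  have : z \in s by have : [set` s] z by rewrite -sE.
  by move/hm; rewrite zz; lia.
apply: (@sub_finite_set _ _
  (\bigcup_(n in `I_(maxn m e.+1)) [set z | zn z = n /\ ~ built z])); last first.
  by apply: bigcup_finite => [|n _]; [exact: finite_II | exact: column_finite].
move=> z [Wz nz]; exists (zn z) => //=.
rewrite ltnNge geq_max; apply/negP => /andP[mz ez]; apply: nm.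
have [w hw] : exists w, meets e (zn z) w by apply/meetsP => //; exists z.
by exists (npair (zn z) w); rewrite !npairE mz ez hw.
Qed.

(** The inner existential question of [finite_meets] is a query to the jump; the outer quantifier
    over [m] then becomes a query to the second jump. *)
Lemma built_semilow15 : semilow15 (~` built).
Proof.
pose P p := [&& nsnd (nfst p) <= nfst (nsnd p), nfst (nfst p) < nfst (nsnd p)
  & meets (nfst (nfst p)) (nfst (nsnd p)) (nsnd (nsnd p))].
have hP : decin set0 P.
  rewrite /P /meets /zn.
  by repeat (first [rec_step | apply: decin_enters | apply: decin_alive]; cbv beta).
have [f [hf _ fP]] := sigma1_le_jump hP.
have hj : decin (jump set0) (fun x => ~~ `[< jump set0 (f x) >]).
  have /turing_leE h := turing_le_refl (jump set0).
  by apply: decin_neg; exact: (recin_comp h (hf _)).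
have [g [hg g_inj gP]] := sigma1_le_jump hj.
exists g; split=> [|//|e]; first exact/recin_computable/hg.
rewrite -gP; apply: (iff_trans (finite_meets e)); split=> -[m hm]; exists m.
  apply/asboolPn; apply: contra_not hm => /fP[p]; rewrite /P !npairE => hp.
  by exists p.
move/asboolPn: hm; apply: contra_not => -[p hp]; apply/fP; exists p.
by rewrite /P !npairE.
Qed.

(** * Enumerability of the set and coding by copies *)

Lemma built_ce : ce built.
Proof.
have : ce [set z | exists s, ~~ alive (nfst (npair z s)) (nsnd (npair z s))].
  by apply: (@ce_search (fun p => ~~ alive (nfst p) (nsnd p)));
    repeat (first [rec_step | apply: decin_alive]; cbv beta).
congr ce; apply/seteqP; split=> z [s]; rewrite ?npairE => hs; exists s => //.
by rewrite !npairE.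
Qed.

(** Since [b] tells which candidates are ever refuted, survival is also enumerable in [O]: the
    candidate is never refuted, or a save is found. *)
Lemma built_turing_le O (b : nat -> nat -> bool) :
  (forall f g, recin O f -> recin O g -> decin O (fun x => b (f x) (g x))) ->
  (forall n c, b n c <-> exists t, bad n c t) -> turing_le built O.
Proof.
move=> hb bP.
apply: (@turing_le_delta1 _ _ (fun p => ~~ alive (nfst p) (nsnd p)) (fun p =>
  start (nfst p) && (~~ b (zn (nfst p)) (zc (nfst p)) ||
    bex (zn (nfst p)) (fun e => choice_at e (zn (nfst p)) (nsnd p)
      && (nfst (nsnd p) == nfst p))))).
- by repeat (first [rec_step | apply: decin_alive]; cbv beta).
- rewrite /zn /zc.
  by repeat (first [rec_step | apply: decin_start | apply: decin_choice | apply: hb];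
    cbv beta).
- by move=> z; split=> -[s]; rewrite ?npairE => hs; exists s; rewrite ?npairE.
move=> z; split=> [/notin_built al|[w]].
  case bz: (b (zn z) (zc z)); last first.
    by exists 0; rewrite !npairE bz andbT; case/andP: (al 0).
  have /bP[s bs] := bz; have /andP[sz] := al s.
  rewrite bs => /bexP[e lte /bexP[w _ hw]]; exists w; rewrite !npairE sz bz.
  by apply/bexP; exists e.
rewrite !npairE => /andP[sz /orP[nb|/bexP[e lte /andP[cw /eqP <-]]]].
  apply/notin_built => s; rewrite /alive sz; case bs: (bad _ _ s) => //.
  by case/negP: nb; apply/bP; exists s.
exact: choice_notin_built lte cw.
Qed.

Definition copy (n j z : nat) : bool := [&& start z, zn z == n & zj z == j].

(** All copies of the least good candidate survive. Conversely, without a good candidate all [n+1]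
    surviving copies would have been saved, against the pigeonhole principle. *)
Lemma good_copies n : (exists c, forall t, ~~ bad n c t) <->
  forall j, j < n.+1 -> exists2 z, copy n j z & ~ built z.
Proof.
split=> [/ex_least[c nc min_c] j ltj|h].
  have [||t0 ht0] := @uniform_bound _ (iota 0 c) (fun c t => bad n c t).
  - by move=> i a b; exact: bad_mono.
  - move=> i; rewrite mem_iota /= => /min_c; apply: contra_notP => nb t.
    by apply/negP => bt; apply: nb; exists t.
  have ex_t : exists t, ball c (fun c => bad n c t).
    by exists t0; apply/ballP => i ltic; apply: ht0; rewrite mem_iota.
  (* Minimality of [t] yields the last clause of [start]. *)
  case: (ex_minnP ex_t) => t ht min_t.
  pose z := npair n (npair c (npair t j)).
  have [En Ec Et Ej] : [/\ zn z = n, zc z = c, zt z = t & zj z = j].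
    by rewrite /zn /zc /zt /zj !npairE.
  have sz : start z.
    rewrite /start En Ec Et Ej -ltnS ltj ht; apply/ballP => u ltut.
    by apply: contraTT ltut => nu; rewrite -leqNgt; exact: min_t nu.
  exists z; first by rewrite /copy sz En Ej !eqxx.
  by apply/notin_built => s; rewrite /alive sz En Ec nc.
case: (pselect (exists c, forall t, ~~ bad n c t)) => // nN; exfalso.
have keep j : j < n.+1 ->
    exists e, e < n /\ exists2 w, choice_at e n w & zj (nfst w) = j.
  move=> /h[z /and3P[sz /eqP zz /eqP jz] /notin_built al].
  have [s bs] : exists s, bad n (zc z) s.
    apply: contra_notP nN => nb; exists (zc z) => t.
    by apply/negP => bt; apply: nb; exists t.
  have /andP[_] := al s; rewrite /kept zz bs => /bexP[e lte /bexP[w _ /andP[cw /eqP wz]]].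
  by exists e; split=> //; exists w; rewrite ?wz.
(* Each copy number is sent to the index of a set that saved such a copy. *)
have /choice[f fP] : forall j : 'I_n.+1, exists e : 'I_n,
    exists2 w, choice_at e n w & zj (nfst w) = j.
  by move=> j; have [e [lte ?]] := keep j (ltn_ord j); exists (Ordinal lte).
have f_inj : injective f.
  move=> j j' Ef; have [w cw wj] := fP j; have [w' cw' wj'] := fP j'.
  by apply: val_inj; rewrite /= -wj -wj' -Ef in cw' *; rewrite (choice_uniq cw cw').
by have := leq_card f f_inj; rewrite !card_ord ltnn.
Qed.

End Construction.

(** * Refutable computations with a c.e. oracle *)

Definition seen (e x s : nat) : bool := bex s (enters e x).

Lemma seen_mono e x s t : s <= t -> seen e x s -> seen e x t.
Proof.
by move=> st /bexP[L ltLs eL]; apply/bexP; exists L => //; exact: leq_trans st.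
Qed.

Lemma W_seen e x : W e x <-> exists s, seen e x s.
Proof.
split=> [/W_enters[L eL]|[s /bexP[L _ eL]]]; last by apply/W_enters; exists L.
by exists L.+1; apply/bexP; exists L.
Qed.

Lemma decin_seen O f g h : recin O f -> recin O g -> recin O h ->
  decin O (fun x => seen (f x) (g x) (h x)).
Proof.
by move=> hf hg hh; rewrite /seen;
  repeat (first [rec_step | apply: decin_enters]; cbv beta).
Qed.

(* A pair [c] of a derivation and a stage [s] represents a halting computation
   with oracle [W e] on input [n] whose positive queries are answered correctly
   because they are in [W e] by stage [s]; it can only be refuted, at some stage,
   by a negative query. *)
Definition accepted (e n c : nat) : bool :=
  halts n n (nfst c) && ~~ claimed (nfst c) (fun q =>
    [&& te q == 4, ty q == 1 & ~~ seen e (tx q) (nsnd c)]).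

(** An answer other than 0 and 1 is wrong for every oracle; an answer 0 is refuted once [d] holds of
    the query. *)
Definition refuted (d : nat -> bool) (c : nat) : bool :=
  claimed (nfst c) (fun q =>
    [&& te q == 4, ty q != 1 & (ty q != 0) || d (tx q)]).

Definition bad (e n c t : nat) : bool :=
  ~~ accepted e n c || refuted (fun x => seen e x t) c.

Lemma refuted_mono (d d' : nat -> bool) c :
  subpred d d' -> refuted d c -> refuted d' c.
Proof.
move=> dd'; rewrite /refuted !claimedP; apply: sub_has => q /and3P[-> ->] /=.
by case/orP => [->|/dd' ->]; rewrite ?orbT.
Qed.

Lemma bad_mono e n c s t : s <= t -> bad e n c s -> bad e n c t.
Proof.
move=> st /orP[ac|re]; apply/orP; [by left | right].
by apply: refuted_mono re => x; exact: seen_mono.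
Qed.

Lemma decin_accepted O e f g : recin O f -> recin O g ->
  decin O (fun x => accepted e (f x) (g x)).
Proof.
move=> hf hg; rewrite /accepted /claimed /te /ty /tx.
by repeat (first [rec_step | apply: decin_halts | apply: decin_seen]; cbv beta).
Qed.

Lemma decin_bad e O f g h : recin O f -> recin O g -> recin O h ->
  decin O (fun x => bad e (f x) (g x) (h x)).
Proof.
move=> hf hg hh; rewrite /bad /refuted /claimed /te /ty /tx.
by repeat (first [rec_step | apply: decin_accepted | apply: decin_seen]; cbv beta).
Qed.

Lemma decin_refuted O d f : decin O d -> recin O f ->
  decin O (fun x => refuted d (f x)).
Proof. by move=> hd hf; rewrite /refuted /claimed /te /ty /tx; rec_tac. Qed.

(** A wrong negative answer is exposed at a finite stage. The left side is decidable in [W e], as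
    needed for [built_turing_le]. *)
Lemma ever_bad e n c :
  ~~ accepted e n c || refuted (fun x => `[< W e x >]) c <->
  exists t, bad e n c t.
Proof.
split=> [/orP[ac|]|[t /orP[->//|re]]]; first by exists 0; rewrite /bad ac.
  rewrite /refuted claimedP => /hasP[q qL /and3P[q4 q1 qW]].
  have [t ht] : exists t, (ty q != 0) || seen e (tx q) t.
    case/orP: qW => [q0|/asboolP/W_seen[t st]]; first by exists 0; rewrite q0.
    by exists t; rewrite st orbT.
  exists t; apply/orP; right; rewrite /refuted claimedP; apply/hasP; exists q => //.
  by rewrite q4 q1.
apply/orP; right; apply: refuted_mono re => x sx.
by apply/asboolP/W_seen; exists t.
Qed.

Lemma jump_bad e n : jump (W e) n <-> exists c, forall t, ~~ bad e n c t.
Proof.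
rewrite [jump _ _]halting; split=> [[L hL cL]|[c nb]].
  (* By stage [s] all positively answered queries of [L] have been seen in [W e]; the candidate is
     [npair L s]. *)
  have [|q qL|s hs] := @uniform_bound _ (claims L)
    (fun q s => te q = 4 -> ty q = 1 -> seen e (tx q) s).
  - by move=> q a b ab h q4 q1; apply: seen_mono ab (h q4 q1).
  - case: (pselect (te q = 4 /\ ty q = 1)) => [[q4 q1]|nq].
      by case: (cL q qL q4) => -[Wq]; [have /W_seen[s hs] := Wq; exists s | rewrite q1].
    by exists 0 => q4 q1; case: nq.
  exists (npair L s); suff nE : ~ exists t, bad e n (npair L s) t.
    by move=> t; apply/negP => bt; apply: nE; exists t.
  move/ever_bad; rewrite /accepted /refuted !npairE hL !claimedP /=.
  case/orP => [/negPn|] /hasP[q qL /and3P[/eqP q4]].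
    by move=> /eqP q1; rewrite hs.
  move=> q1; case: (cL q qL q4) => -[Wq]; first by move=> q1'; rewrite q1' in q1.
  by move=> ->; rewrite /= => /asboolP.
have : ~ exists t, bad e n c t by move=> [t]; exact/negP/nb.
move/ever_bad/negP; rewrite negb_or negbK => /andP[/andP[hL]].
rewrite /refuted !claimedP => /hasPn pos /hasPn neg; exists (nfst c) => //.
move=> q qL q4; have := pos q qL; have := neg q qL; rewrite q4 /=.
case: (eqVneq (ty q) 1) => [q1 _ /negPn sq|q1] /=.
  by left; split=> //; apply/W_seen; exists (nsnd c).
by rewrite negb_or negbK => /andP[/eqP q0 /asboolP nW] _; right.
Qed.

(** * Degree and jump of the constructed set *)

Lemma jump_set0_le O : turing_le (jump set0) (jump O).
Proof.
pose P p := enters (nfst p) (nfst p) (nsnd p).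
have [|f [hf _ fP]] := @sigma1_le_jump O P.
  by apply: decin_enters; rec_tac.
apply: (turing_le_many_one (hf _)) => x; rewrite -fP [jump _ _]W_enters.
by split=> -[L eL]; exists L; move: eL; rewrite /P !npairE.
Qed.

Lemma nonlow_jump O : ~ low O -> ~ turing_le (jump O) (jump set0).
Proof. by move=> nl le; apply: nl; split=> //; exact: jump_set0_le. Qed.

Section Degree.

Variable e : nat.

Let A := built (bad e).

Lemma built_le : turing_le A (W e).
Proof.
have /turing_leE hW := turing_le_refl (W e).
apply: (built_turing_le (@decin_bad e) (@bad_mono e)) (@ever_bad e) => f g hf hg.
by repeat (first [rec_step | apply: decin_accepted | apply: decin_refuted]; cbv beta).
Qed.

Lemma jump_copies n : jump (W e) n <->
  forall j, j < n.+1 -> exists2 z, copy (bad e) n j z & ~ A z.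
Proof. by rewrite jump_bad; exact: (good_copies (@bad_mono e)). Qed.

Lemma decin_copy O f g h : recin O f -> recin O g -> recin O h ->
  decin O (fun x => copy (bad e) (f x) (g x) (h x)).
Proof.
move=> hf hg hh; rewrite /copy /zn /zj.
by repeat (first [rec_step | apply: (decin_start (@decin_bad e))]; cbv beta).
Qed.

(** [q] reduces the complement of [W e] to the jump of [W e], and [jump_copies] turns that jump into
    a search in [A]. *)
Lemma le_built : turing_le (W e) A.
Proof.
have /turing_leE hW := turing_le_refl (W e).
have [|q [hq _ qP]] := @sigma1_le_jump (W e) (fun p => ~~ `[< W e (nfst p) >]).
  by apply: decin_neg; exact: (recin_comp hW (recin_fst (recin_id _))).
have /turing_leE hA := turing_le_refl A.
set a := fun x => `[< A x >] in hA.
(* A witness for the complement codes one surviving [j]-th copy for each [j <= q x]. *)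
apply: (@turing_le_delta1 _ _ (fun p => enters e (nfst p) (nsnd p)) (fun p =>
  ball (q (nfst p)).+1 (fun j => copy (bad e) (q (nfst p)) j (item (nsnd p) j)
    && ~~ a (item (nsnd p) j)))).
- by apply: decin_enters; rec_tac.
- have hqA := hq A.
  by repeat (first [rec_step | apply: decin_copy]; cbv beta).
- by move=> x; rewrite W_enters; split=> -[L hL]; exists L; move: hL; rewrite !npairE.
move=> x; have -> : ~ W e x <-> jump (W e) (q x).
  rewrite -qP; split=> [nW|[w]]; last by rewrite npairE => /asboolP.
  by exists 0; rewrite npairE; apply/asboolP.
rewrite jump_copies; split=> [h|[S]].
  have [|S hS] := @item_seq (q x).+1 (fun j z => copy (bad e) (q x) j z && ~~ a z).
    by move=> j /h[z cz nz]; exists z; rewrite cz; apply/asboolP.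
  by exists S; rewrite !npairE; apply/ballP.
rewrite !npairE => /ballP hS j /hS/andP[cS /asboolP nS].
by exists (item S j).
Qed.

(** By [jump_copies], membership of [n] in the jump amounts to [n+1] questions whether a c.e. set
    meets the complement of [A]. *)
Lemma semilow_jump : semilow (~` A) -> turing_le (jump (W e)) (jump set0).
Proof.
move=> /turing_leE; set m := fun x => `[< _ >] => hm.
(* [v (npair n j)] indexes the set of [j]-th copies in column [n]; the condition ignores the search
   witness, hence the dummy 0 below. *)
have [|v [hv vP]] := @ce_uniform (fun p => copy (bad e)
    (nfst (nfst (nfst p))) (nsnd (nfst (nfst p))) (nsnd (nfst p))).
  by apply: decin_copy; rec_tac.
apply/turing_leE.
apply: (@decin_ext _ (fun n => ball n.+1 (fun j => m (v (npair n j))))); last first.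
  by have := hv (jump set0) => hv'; rec_tac.
move=> n; apply/ballP/asboolP => [h|/jump_copies h j /h[z cz nz]].
  apply/jump_copies => j /h/asboolP[z [/vP[w]]]; rewrite !npairE => cz nz.
  by exists z.
by apply/asboolP; exists z; split=> //; apply/vP; exists 0; rewrite !npairE.
Qed.

End Degree.

Theorem theorem4p1 : forall (d : set (set nat)),
  ce_degree d -> ~ low_degree d ->
  exists A : set nat,
    [/\ d A, ce A, semilow15 (~` A) & ~ semilow (~` A)].
Proof.
move=> d [[D0 dE] [D dD [e DE]]] nlow; subst D.
have /nonlow_jump nD : ~ low (W e) by move=> lD; apply: nlow; exists (W e).
exists (built (bad e)); split.
- move: dD; rewrite dE => -[D0W WD0]; split.
    by apply: turing_le_trans D0W; exact: built_le.
  by apply: turing_le_trans WD0 _; exact: le_built.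
- exact: (built_ce (@decin_bad e)).
- exact: (built_semilow15 (@decin_bad e) (@bad_mono e)).
- by move/semilow_jump.
Qed.
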